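(* Let $G$ be a finite simple graph and let $\overline{K}_m$ denote the complement of the complete graph $K_m$, i.e. the graph on $m$ vertices with no edges (with vertex set disjoint from that of $G$). Then $$H_{\mathbb{K}[G*\overline{K}_m]}(t)=H_{\mathbb{K}[G]}(t)+\frac{1}{(1-t)^m}-1.$$ In particular, for the complete bipartite graph $K_{m,n}$, $$H_{\mathbb{K}[K_{m,n}]}(t)=\frac{1}{(1-t)^n}+\frac{1}{(1-t)^m}-1.$$
   Context: $\mathbb{K}$ is a field. For a finite simple graph $G$ with vertex set $V(G)=\{x_1,\dots,x_n\}$, the edge ring is $\mathbb{K}[G]=\mathbb{K}[x_1,\dots,x_n]/I(G)$, where $I(G)$ is generated by the monomials $x_ix_j$ with $\{x_i,x_j\}\in E(G)$. $H_{\mathbb{K}[G]}(t)$ denotes its Hilbert series with respect to the standard grading. $K_{m,n}$ is the complete bipartite graph whose parts have $m$ and $n$ vertices. For graphs $G,H$ with $V(G)\cap V(H)=\emptyset$, the product $G*H$ is the graph on $V(G)\cup V(H)$ with edge set $E(G)\cup E(H)\cup\{\{x,y\}\mid x\in V(G),\ y\in V(H)\}$. *)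

(* Defs.v *)
From HB Require Import structures.
From mathcomp Require Import all_boot all_algebra.
From mathcomp Require Import ring_quotient.
From mathcomp Require Import boolp classical_sets.
From mathcomp.multinomials Require Import mpoly.

Set Implicit Arguments.
Unset Strict Implicit.
Unset Printing Implicit Defensive.

Import GRing.Theory.

Local Open Scope ring_scope.
Local Open Scope quotient_scope.

Record fps (R : Type) := Fps { coefs : nat -> R }.

Section FpsRing.
Variable R : comUnitRingType.
Implicit Types f g h : fps R.

Lemma fpsP f g : coefs f =1 coefs g -> f = g.
Proof. by case: f g => [f] [g] /= /funext ->. Qed.

HB.instance Definition _ := gen_eqMixin (fps R).
HB.instance Definition _ := gen_choiceMixin (fps R).

Definition fps_zero : fps R := Fps (fun=> 0).
Definition fps_opp f := Fps (fun n => - coefs f n).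
Definition fps_add f g := Fps (fun n => coefs f n + coefs g n).
Definition fps_one : fps R := Fps (fun n => (n == 0%N)%:R).
Definition fps_mul f g :=
  Fps (fun n => \sum_(i < n.+1) coefs f i * coefs g (n - i)).

Fact fps_addA : associative fps_add.
Proof. by move=> f g h; apply: fpsP => n /=; rewrite addrA. Qed.
Fact fps_addC : commutative fps_add.
Proof. by move=> f g; apply: fpsP => n /=; rewrite addrC. Qed.
Fact fps_add0 : left_id fps_zero fps_add.
Proof. by move=> f; apply: fpsP => n /=; rewrite add0r. Qed.
Fact fps_addN : left_inverse fps_zero fps_opp fps_add.
Proof. by move=> f; apply: fpsP => n /=; rewrite addNr. Qed.

HB.instance Definition _ :=
  GRing.isZmodule.Build (fps R) fps_addA fps_addC fps_add0 fps_addN.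

Let trunc N f : {poly R} := \poly_(i < N) coefs f i.

Let mul_trunc N f g n :
  (n < N)%N -> coefs (fps_mul f g) n = (trunc N f * trunc N g)`_n.
Proof.
move=> ltnN; rewrite coefM; apply: eq_bigr => i _; rewrite !coef_poly.
by rewrite (leq_trans (ltn_ord i) ltnN) (leq_ltn_trans (leq_subr _ _) ltnN).
Qed.

Fact fps_mulC : commutative fps_mul.
Proof. by move=> f g; apply: fpsP => n; rewrite !(mul_trunc _ _ (ltnSn n)) mulrC. Qed.

Fact fps_mulA : associative fps_mul.
Proof.
have lem f g h n : coefs (fps_mul f (fps_mul g h)) n =
    (trunc n.+1 f * (trunc n.+1 g * trunc n.+1 h))`_n.
  rewrite coefM; apply: eq_bigr => i _.
  by rewrite (mul_trunc (N := n.+1)) ?ltnS ?leq_subr // coef_poly ltn_ord.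
move=> f g h; apply: fpsP => n.
by rewrite lem [fps_mul _ h]fps_mulC lem mulrA mulrC.
Qed.

Fact fps_mul1 : left_id fps_one fps_mul.
Proof.
move=> f; apply: fpsP => n /=; rewrite big_ord_recl /= subn0 mul1r big1 ?addr0 //.
by move=> i _; rewrite mul0r.
Qed.

Fact fps_mulDl : left_distributive fps_mul fps_add.
Proof.
move=> f g h; apply: fpsP => n /=; rewrite -big_split /=.
by apply: eq_bigr => i _; rewrite mulrDl.
Qed.

Fact fps_one_neq0 : fps_one != 0.
Proof.
apply/eqP => /(congr1 (fun f => coefs f 0%N)) /= /eqP.
by rewrite oner_eq0.
Qed.

HB.instance Definition _ := GRing.Zmodule_isComNzRing.Build (fps R)
  fps_mulA fps_mulC fps_mul1 fps_mulDl fps_one_neq0.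

(* The coefficients of the inverse g of f solve f g = 1 degree by degree:
   f_0 g_n = [n = 0] - \sum_(i < n) f_(n - i) g_i. *)
Fixpoint fps_inv_prefix f n : seq R :=
  if n is n'.+1 then
    let s := fps_inv_prefix f n' in
    rcons s ((coefs f 0)^-1 *
             ((n' == 0%N)%:R - \sum_(i < n') coefs f (n' - i) * s`_i))
  else [::].

Definition fps_unit : pred (fps R) := fun f => coefs f 0 \is a GRing.unit.

Definition fps_inv f : fps R :=
  if fps_unit f then Fps (fun n => (fps_inv_prefix f n.+1)`_n) else f.

Let size_prefix f n : size (fps_inv_prefix f n) = n.
Proof. by elim: n => //= n IHn; rewrite size_rcons IHn. Qed.

Let nth_prefix f n i : (i < n)%N ->
  (fps_inv_prefix f n)`_i = (fps_inv_prefix f i.+1)`_i.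
Proof.
elim: n => // n IHn; rewrite ltnS leq_eqVlt => /predU1P[-> //|ltin].
by rewrite [fps_inv_prefix f n.+1]/= nth_rcons size_prefix ltin IHn.
Qed.

Let inv_prefixE f n : (fps_inv_prefix f n.+1)`_n =
  (coefs f 0)^-1 * ((n == 0%N)%:R -
    \sum_(i < n) coefs f (n - i) * (fps_inv_prefix f i.+1)`_i).
Proof.
rewrite [fps_inv_prefix f n.+1]/= nth_rcons size_prefix ltnn eqxx.
by congr (_ * (_ - _)); apply: eq_bigr => i _; rewrite nth_prefix.
Qed.

Fact fps_mulVf : {in fps_unit, left_inverse 1 fps_inv *%R}.
Proof.
move=> f Uf; apply: fpsP => n; rewrite /fps_inv (Uf : fps_unit f).
rewrite [LHS]big_ord_recr [coefs _ _]inv_prefixE.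
rewrite [nat_of_ord _]/= subnn [_^-1 * _]mulrC divrK //.
apply: etrans (addrC _ _) _; apply: etrans (subrK _ _); congr (_ + _).
by apply: eq_bigr => i _; rewrite mulrC.
Qed.

Fact fps_unitP f g : g * f = 1 -> fps_unit f.
Proof.
move=> /(congr1 (fun h => coefs h 0%N)); rewrite {1}/GRing.mul /=.
rewrite big_ord1 => gf1.
by apply/unitrPr; exists (coefs g 0); rewrite mulrC.
Qed.

Fact fps_inv_out : {in [predC fps_unit], fps_inv =1 id}.
Proof. by move=> f nUf; rewrite /fps_inv ifN. Qed.

HB.instance Definition _ := GRing.ComNzRing_hasMulInverse.Build (fps R)
  fps_mulVf fps_unitP fps_inv_out.

Definition fpsX : fps R := Fps (fun n => (n == 1%N)%:R).
End FpsRing.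

Arguments fpsX {R}.

Section SubspaceDim.
Variables (K : fieldType) (V : lmodType K).

Definition is_basis (A : set V) (h : nat) (b : 'I_h -> V) : Prop :=
  [/\ forall i, A (b i),
      forall c : 'I_h -> K, \sum_i c i *: b i = 0 -> forall i, c i = 0
    & forall v, A v -> exists c : 'I_h -> K, v = \sum_i c i *: b i].

(* The value is 0 when A has no finite basis. *)
Definition subspace_dim (A : set V) : nat :=
  xget 0%N [set h | exists b : 'I_h -> V, is_basis A b].

Lemma is_basis_leq (A : set V) h h' (b : 'I_h -> V) (b' : 'I_h' -> V) :
  is_basis A b -> is_basis A b' -> (h <= h')%N.
Proof.
move=> [Ab freeb _] [Ab' _ spanb'].
have /choice[c cE] i : exists c : 'I_h' -> K, b i = \sum_j c j *: b' j.
  exact: spanb'.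
pose M : 'M[K]_(h, h') := \matrix_(i, j) c i j.
suff : row_free M by move/eqP <-; exact: rank_leq_col.
rewrite -kermx_eq0; apply/eqP/row_matrixP => k; rewrite row0.
set u := row k _; have uM0 : u *m M = 0 by apply/sub_kermxP/row_sub.
apply/rowP => i; rewrite [RHS]mxE; apply: (freeb (u 0)).
under eq_bigr do rewrite cE scaler_sumr.
rewrite exchange_big big1 // => j _.
under eq_bigr do rewrite scalerA.
rewrite -scaler_suml; move/rowP/(_ j): uM0; rewrite !mxE => uMj0.
suff -> : \sum_k' u 0 k' * c k' j = 0 by rewrite scale0r.
by rewrite -[RHS]uMj0; apply: eq_bigr => k' _; rewrite [M _ _]mxE.
Qed.

Lemma subspace_dimE (A : set V) h (b : 'I_h -> V) :
  is_basis A b -> subspace_dim A = h.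
Proof.
move=> bA; rewrite /subspace_dim; case: xgetP => [_ -> [b' b'A]|/(_ h)[]].
  by apply/eqP; rewrite eqn_leq (is_basis_leq bA b'A) (is_basis_leq b'A bA).
by exists b.
Qed.
End SubspaceDim.

Record sgraph (V : finType) := SGraph {
  adj :> rel V;
  adj_sym : ssrbool.symmetric adj;
  adj_irr : irreflexive adj
}.

Definition complete (V : finType) : sgraph V.
Proof.
by exists (fun x y => x != y) => [x y|x] /=; rewrite ?eqxx // eq_sym.
Defined.

Definition complement (V : finType) (G : sgraph V) : sgraph V.
Proof.
exists (fun x y => (x != y) && ~~ G x y) => [x y|x] /=; last by rewrite eqxx.
by rewrite eq_sym adj_sym.
Defined.

(* The sum type V + W is the union of disjoint copies of V and W. *)
Definition join (V W : finType) (G : sgraph V) (H : sgraph W) :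
  sgraph (V + W)%type.
Proof.
exists (fun u v => match u, v with
  | inl x, inl y => G x y
  | inr x, inr y => H x y
  | _, _ => true
  end).
- by move=> [x|x] [y|y] //; apply: adj_sym.
- by move=> [x|x]; apply: adj_irr.
Defined.

Definition complete_bipartite (m n : nat) : sgraph ('I_m + 'I_n)%type.
Proof.
exists (fun u v => match u, v with
  | inl _, inr _ | inr _, inl _ => true
  | _, _ => false
  end).
- by move=> [x|x] [y|y].
- by move=> [x|x].
Defined.

Section EdgeRing.
Variables (K : fieldType) (V : finType) (G : sgraph V).

Local Notation S := {mpoly K[#|{: V}|]}.

Definition var (x : V) : S := 'X_(enum_rank x).

Definition edge_ideal : {pred S} := fun p =>
  `[< exists c : V * V -> S,
        p = \sum_(e : V * V | G e.1 e.2) c e * (var e.1 * var e.2) >].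

Fact edge_ideal_closed : idealr_closed edge_ideal.
Proof.
split.
- by apply/asboolP; exists (fun=> 0); rewrite big1 // => e _; rewrite mul0r.
- apply/asboolP => -[c] /(congr1 (mcoeff 0%MM)) /eqP.
  rewrite mcoeff1 eqxx raddf_sum /= big1 ?oner_eq0 // => e _.
  by rewrite mulrA !rmorphM /= [X in _ * X]mcoeffX mnm1_eq0 mulr0.
- move=> a p q /asboolP[c ->] /asboolP[d ->]; apply/asboolP.
  exists (fun e => a * c e + d e); rewrite mulr_sumr -big_split /=.
  by apply: eq_bigr => e _; rewrite mulrDl -mulrA.
Qed.

HB.instance Definition _ := isIdealr.Build S edge_ideal edge_ideal_closed.

Definition edge_ring := {ideal_quot edge_ideal}.

HB.instance Definition _ := GRing.ComNzRing.on edge_ring.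

Definition edge_proj (p : S) : edge_ring := \pi_{ideal_quot edge_ideal} p.

Definition edge_scale (a : K) (u : edge_ring) : edge_ring :=
  edge_proj a%:MP * u.

Fact edge_scaleA a b u :
  edge_scale a (edge_scale b u) = edge_scale (a * b) u.
Proof. by rewrite /edge_scale mulrA mpolyCM /edge_proj rmorphM. Qed.
Fact edge_scale1 : left_id 1 edge_scale.
Proof. by move=> u; rewrite /edge_scale /edge_proj rmorph1 mul1r. Qed.
Fact edge_scaleDr : right_distributive edge_scale +%R.
Proof. by move=> a u v; rewrite /edge_scale mulrDr. Qed.
Fact edge_scaleDl u : {morph edge_scale^~ u : a b / a + b}.
Proof.
by move=> a b; rewrite /edge_scale mpolyCD /edge_proj rmorphD mulrDl.
Qed.

HB.instance Definition _ := GRing.Zmodule_isLmodule.Build K edge_ring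
  edge_scaleA edge_scale1 edge_scaleDr edge_scaleDl.

Definition edge_ring_component (d : nat) : set edge_ring :=
  [set u | exists2 p : S, p \is d.-homog & u = edge_proj p].

Definition hilbert_series : fps int :=
  Fps (fun d => (subspace_dim (edge_ring_component d))%:Z).
End EdgeRing.

(* Main.v *)
Require Import Defs.
From HB Require Import structures.
From mathcomp Require Import all_boot all_algebra.
From mathcomp Require Import ring_quotient.
From mathcomp Require Import boolp.
From mathcomp.multinomials Require Import mpoly.

Set Implicit Arguments.
Unset Strict Implicit.
Unset Printing Implicit Defensive.

Import GRing.Theory.
Local Open Scope ring_scope.

(** The edge ideal is a monomial ideal: a monomial belongs to it exactly when
    some edge has both endpoints in its support. Hence the monomials of degree
    d whose support is a stable (independent) set of G form a K-basis of the
    degree d component of K[G], and the Hilbert function of K[G] counts them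
    ([stable_monomial_basis], [coefs_hilbert_series]).

    In a join G * H every vertex of G is adjacent to every vertex of H, so a
    stable set lies entirely in G or entirely in H. In degree d > 0 the stable
    monomials of G * H are therefore the disjoint union of those of G and those
    of H; in degree 0 the monomial 1 is counted for both graphs but occurs only
    once. This gives H_(G * H) = H_G + H_H - 1 ([hilbert_series_join]).

    For an edgeless graph on n vertices all monomials are stable, and the
    number 'C(d + n - 1, d) of monomials of degree d is the coefficient of t^d
    in 1 / (1 - t)^n ([hilbert_series_edgeless]). Both formulas follow, since
    K_(m,n) is the join of two edgeless graphs. *)

(** * Stable monomials form a basis of the edge ring *)

Definition stable_support (V : finType) (G : rel V) (f : V -> nat) : bool :=
  [forall x, forall y, G x y ==> (f x == 0%N) || (f y == 0%N)].

(** The exponent vectors of the stable monomials of degree d. Each exponent is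
    at most d, so bounding the values by d loses nothing and makes the set
    finite. *)
Definition stable_exponents (V : finType) (G : rel V) (d : nat) :
    {set {ffun V -> 'I_d.+1}} :=
  [set f : {ffun V -> 'I_d.+1} |
     (\sum_x f x == d)%N && stable_support G (fun x => f x)].

Section MonomialBasis.
Variables (K : fieldType) (V : finType) (G : sgraph V).

Local Notation S := {mpoly K[#|{: V}|]}.
Local Notation expo := 'X_{1..#|{: V}|}.

Definition stable_mnm (m : expo) : bool :=
  stable_support G (fun x => m (enum_rank x)).

Lemma edge_dvd_unstable (x y : V) (m : expo) :
  G x y -> (U_(enum_rank x) + U_(enum_rank y) <= m)%MM -> ~~ stable_mnm m.
Proof.
move=> Gxy /mnm_lepP le_m; apply/negP => /forallP/(_ x)/forallP/(_ y).
rewrite Gxy /=; have := le_m (enum_rank x); have := le_m (enum_rank y).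
by rewrite !mnmDE !mnm1E !eqxx addn1 add1n; case: (m _) => // ?; case: (m _).
Qed.

Lemma unstable_edge_dvd (m : expo) : ~~ stable_mnm m ->
  exists2 e : V * V, G e.1 e.2
    & (U_(enum_rank e.1) + U_(enum_rank e.2) <= m)%MM.
Proof.
case/forallPn => x /forallPn[y]; rewrite negb_imply negb_or -!lt0n.
case/and3P => Gxy mx my; exists (x, y) => //=; apply/mnm_lepP => i.
rewrite mnmDE !mnm1E.
have neq_xy : enum_rank x != enum_rank y.
  by apply: contraTneq Gxy => /enum_rank_inj ->; rewrite adj_irr.
have [<-|] := eqVneq (enum_rank x) i; first by rewrite eq_sym (negPf neq_xy).
by have [<-|] := eqVneq (enum_rank y) i.
Qed.

(** Membership in a monomial ideal is decided monomial by monomial: every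
    monomial of a multiple of x * y is divisible by x * y, and conversely each
    unstable monomial is a multiple of a generator. *)
Lemma mem_edge_ideal (p : S) :
  p \in edge_ideal G <-> forall m, stable_mnm m -> p@_m = 0.
Proof.
split=> [/asboolP[c ->] m stab_m|p0].
  rewrite raddf_sum /= big1 // => -[x y] /= Gxy.
  rewrite -mpolyXD; apply: memN_msupp_eq0.
  rewrite (perm_mem (msuppMX _ _)); apply: contraL stab_m => /mapP[k _ ->].
  by apply: (edge_dvd_unstable Gxy); rewrite lem_addr.
rewrite [p]mpolyE rpred_sum // => m; have [stab_m|unst_m] := boolP (stable_mnm m).
  by rewrite p0 // scale0r idealr0.
have [[x y] /= Gxy le_m] := unstable_edge_dvd unst_m.
rewrite -(submK le_m) mpolyXD -mul_mpolyC mulrA idealMr //.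
(* The generator of the edge (x, y) is the combination supported at (x, y). *)
apply/asboolP; exists (fun e => (e == (x, y))%:R).
rewrite (bigD1 (x, y)) //= eqxx mul1r -mpolyXD big1 ?addr0 // => e /andP[_ /negPf ->].
by rewrite mul0r.
Qed.

Lemma edge_proj_eq (p q : S) :
  edge_proj G p = edge_proj G q <-> forall m, stable_mnm m -> p@_m = q@_m.
Proof.
have -> : edge_proj G p = edge_proj G q <-> p - q \in edge_ideal G.
  by rewrite Quotient.idealrBE; split => /eqP.
rewrite mem_edge_ideal; split=> pq m /pq.
  by rewrite mcoeffB => /eqP; rewrite subr_eq0 => /eqP.
by rewrite mcoeffB => ->; rewrite subrr.
Qed.

Lemma edge_projZ (a : K) (p : S) : edge_proj G (a *: p) = a *: edge_proj G p.
Proof. by rewrite -mul_mpolyC /edge_proj rmorphM. Qed.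

Lemma edge_proj_sum h (p : 'I_h -> S) :
  edge_proj G (\sum_i p i) = \sum_i edge_proj G (p i).
Proof. exact: raddf_sum. Qed.

Definition mnm_of d (f : {ffun V -> 'I_d.+1}) : expo :=
  [multinom (f (enum_val i) : nat) | i < #|{: V}|].

Lemma mnm_ofE d (f : {ffun V -> 'I_d.+1}) x : mnm_of f (enum_rank x) = f x.
Proof. by rewrite mnmE enum_rankK. Qed.

Lemma mnm_of_inj d : injective (@mnm_of d).
Proof.
by move=> f g fg; apply/ffunP => x; apply: val_inj; rewrite /= -!mnm_ofE fg.
Qed.

Lemma mdeg_vertices (m : expo) : mdeg m = (\sum_x m (enum_rank x))%N.
Proof.
rewrite mdegE (reindex (@enum_rank V)) //.
by exists enum_val => x _; rewrite (enum_rankK, enum_valK).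
Qed.

Lemma mem_stable_exponents d (f : {ffun V -> 'I_d.+1}) :
  (f \in stable_exponents G d) = (mdeg (mnm_of f) == d) && stable_mnm (mnm_of f).
Proof.
rewrite inE mdeg_vertices; congr (_ && _).
  by congr (_ == _); apply: eq_bigr => x _; rewrite mnm_ofE.
by apply: eq_forallb => x; apply: eq_forallb => y; rewrite !mnm_ofE.
Qed.

Lemma mnm_of_surj (m : expo) :
  exists f : {ffun V -> 'I_(mdeg m).+1}, mnm_of f = m.
Proof.
exists [ffun x => inord (m (enum_rank x))].
apply/mnmP => i; rewrite mnmE ffunE inordK ?enum_valK // ltnS.
by rewrite mdegE (bigD1 i) //= leq_addr.
Qed.

(** A class in K[G] is determined by the stable coefficients of any of its
    representatives ([edge_proj_eq]). Comparing these coefficients gives both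
    linear independence and the expansion of a homogeneous class, whose
    coordinates are the stable coefficients of a homogeneous representative. *)
Lemma stable_monomial_basis d :
  is_basis (@edge_ring_component K V G d)
    (fun i : 'I_#|stable_exponents G d| => 
       edge_proj G 'X_[mnm_of (enum_val i)]).
Proof.
have coefP (c : 'I_#|stable_exponents G d| -> K) i :
    (\sum_j c j *: 'X_[mnm_of (enum_val j)] : S)@_(mnm_of (enum_val i)) = c i.
  rewrite raddf_sum (bigD1 i) //= mcoeffZ mcoeffX eqxx mulr1 big1 ?addr0 // => j.
  rewrite mcoeffZ mcoeffX (inj_eq (@mnm_of_inj d)) (inj_eq enum_val_inj).
  by move/negPf ->; rewrite mulr0.
split=> [i|c c0 i|_ [p hom_p ->]].
- exists 'X_[mnm_of (enum_val i)] => //.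
  by rewrite dhomogX; have := enum_valP i; rewrite mem_stable_exponents => /andP[].
- have := enum_valP i; rewrite mem_stable_exponents => /andP[_ stab_i].
  have /edge_proj_eq/(_ _ stab_i) :
      edge_proj G (\sum_j c j *: 'X_[mnm_of (enum_val j)]) = edge_proj G 0.
    rewrite edge_proj_sum; under eq_bigr do rewrite edge_projZ.
    by rewrite c0 /edge_proj raddf0.
  by rewrite coefP mcoeff0.
- exists (fun i => p@_(mnm_of (enum_val i))).
  under eq_bigr do rewrite -edge_projZ.
  rewrite -edge_proj_sum; apply/edge_proj_eq => m stab_m.
  have [deg_m|deg_m] := eqVneq (mdeg m) d; last first.
    rewrite (dhomog_nemf_coeff hom_p deg_m) raddf_sum big1 //= => i _.
    rewrite mcoeffZ mcoeffX; case: eqP => [eq_m|]; last by rewrite mulr0.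
    have := enum_valP i; rewrite mem_stable_exponents eq_m.
    by rewrite (negPf deg_m).
  (* Identifying d with the degree of m lets the bounded exponent function
     of m live in the index type of the basis. *)
  case: d / deg_m coefP hom_p => coefP _.
  have [f fm] := mnm_of_surj m.
  have Ef : f \in stable_exponents G (mdeg m).
    by rewrite mem_stable_exponents fm eqxx.
  have [i im] : exists i : 'I_#|stable_exponents G (mdeg m)|,
      mnm_of (enum_val i) = m.
    by exists (enum_rank_in Ef f); rewrite enum_rankK_in.
  by have := coefP (fun i => p@_(mnm_of (enum_val i))) i; rewrite /= im => ->.
Qed.

Lemma coefs_hilbert_series d :
  coefs (hilbert_series K G) d = #|stable_exponents G d|%:Z.
Proof. by congr Posz; exact: subspace_dimE (stable_monomial_basis d). Qed.

End MonomialBasis.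

(** * Stable monomials of a join *)

Lemma card_stable_exponents0 (V : finType) (G : rel V) :
  #|stable_exponents G 0| = 1%N.
Proof.
have -> : stable_exponents G 0 = [set: {ffun V -> 'I_1}].
  apply/setP => f; rewrite !inE big1 /= => [|x _]; last by rewrite ord1.
  by apply/forallP => x; apply/forallP => y; rewrite ord1 implybT.
by rewrite cardsT card_ffun card_ord exp1n.
Qed.

Section Join.
Variables (V W : finType) (G : sgraph V) (H : sgraph W) (d : nat).

Definition extend_left (f : {ffun V -> 'I_d.+1}) : {ffun V + W -> 'I_d.+1} :=
  [ffun u => if u is inl x then f x else ord0].

Definition extend_right (f : {ffun W -> 'I_d.+1}) : {ffun V + W -> 'I_d.+1} :=
  [ffun u => if u is inr y then f y else ord0].

Lemma extend_left_inj : injective extend_left.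
Proof.
by move=> f g /ffunP fg; apply/ffunP => x; have := fg (inl x); rewrite !ffunE.
Qed.

Lemma extend_right_inj : injective extend_right.
Proof.
by move=> f g /ffunP fg; apply/ffunP => y; have := fg (inr y); rewrite !ffunE.
Qed.

Lemma mem_extend_left f :
  (extend_left f \in stable_exponents (join G H) d)
    = (f \in stable_exponents G d).
Proof.
rewrite !inE big_sumType /= [X in (_ + X)%N]big1 => [|y _]; last by rewrite ffunE.
rewrite addn0; congr (_ && _).
  by congr (_ == _); apply: eq_bigr => x _; rewrite ffunE.
apply/forallP/forallP => stab u.
  apply/forallP => v; have /forallP/(_ (inl v)) := stab (inl u).
  by rewrite !ffunE.
apply/forallP => v; case: u v => [x|y] [x'|y']; rewrite !ffunE /= ?orbT ?implybT //.
by have /forallP := stab x.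
Qed.

Lemma mem_extend_right f :
  (extend_right f \in stable_exponents (join G H) d)
    = (f \in stable_exponents H d).
Proof.
rewrite !inE big_sumType /= big1 => [|y _]; last by rewrite ffunE.
rewrite add0n; congr (_ && _).
  by congr (_ == _); apply: eq_bigr => x _; rewrite ffunE.
apply/forallP/forallP => stab u.
  apply/forallP => v; have /forallP/(_ (inr v)) := stab (inr u).
  by rewrite !ffunE.
apply/forallP => v; case: u v => [x|y] [x'|y']; rewrite !ffunE /= ?orbT ?implybT //.
by have /forallP := stab y.
Qed.

(** If f is positive at some vertex y of H, the edges from y to all of G force f
    to vanish on G; otherwise f vanishes on H. *)
Lemma stable_exponents_join :
  stable_exponents (join G H) d =
    extend_left @: stable_exponents G d :|: extend_right @: stable_exponents H d.
Proof.
apply/setP => f; apply/idP/setUP => [|[]/imsetP[g Eg ->]]; last first.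
- by rewrite mem_extend_right.
- by rewrite mem_extend_left.
move=> Ef; have := Ef; rewrite inE => /andP[_ /forallP stab].
have [f0|/forallPn[y fy]] := boolP [forall y, f (inr y) == ord0].
  have eq_f : f = extend_left [ffun x => f (inl x)].
    by apply/ffunP => -[x|y]; rewrite !ffunE //; apply/eqP/(forallP f0).
  by left; rewrite eq_f imset_f // -mem_extend_left -eq_f.
have eq_f : f = extend_right [ffun y => f (inr y)].
  apply/ffunP => -[x|z]; rewrite !ffunE //; apply/val_inj/eqP.
  by have /forallP/(_ (inr y)) := stab (inl x); rewrite /= (negPf fy : _ == 0 = _)%N orbF.
by right; rewrite eq_f imset_f // -mem_extend_right -eq_f.
Qed.

(** The two families meet only in the zero exponent vector, which has degree
    0; hence the restriction to positive degrees. *)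
Lemma card_stable_exponents_join : (0 < d)%N ->
  #|stable_exponents (join G H) d| =
    (#|stable_exponents G d| + #|stable_exponents H d|)%N.
Proof.
move=> d_gt0; rewrite stable_exponents_join cardsU.
rewrite !card_imset; [|exact: extend_right_inj|exact: extend_left_inj].
suff -> : extend_left @: stable_exponents G d
    :&: extend_right @: stable_exponents H d = set0 by rewrite cards0 subn0.
apply/setP => f; rewrite inE in_set0.
apply/negP => /andP[/imsetP[g Eg ->]/imsetP[h _ /ffunP gh]].
move: Eg; rewrite inE big1 => [/andP[/eqP d0]|x _]; first by rewrite -d0 in d_gt0.
by have := gh (inl x); rewrite !ffunE => ->.
Qed.

End Join.

(** The term - 1 corrects degree 0, where each of the three graphs has the single
    stable monomial 1. *)
Lemma hilbert_series_join (K : fieldType) (V W : finType) (G : sgraph V)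
    (H : sgraph W) :
  hilbert_series K (join G H) = hilbert_series K G + hilbert_series K H - 1.
Proof.
apply: fpsP => d.
transitivity (coefs (hilbert_series K G) d + coefs (hilbert_series K H) d
    - (d == 0%N)%:R); last by [].
rewrite !coefs_hilbert_series.
case: d => [|d]; first by rewrite !card_stable_exponents0.
by rewrite card_stable_exponents_join // PoszD subr0.
Qed.

(** * Edgeless graphs and powers of 1 / (1 - t) *)

(** Every exponent vector of sum d is stable, so these are the weak compositions
    of d into #|V| parts. With the truncated predecessor the formula also holds
    for empty V, where 'C(d.-1, d) is 1 if d = 0 and 0 otherwise. *)
Lemma card_stable_exponents_edgeless (V : finType) (G : rel V) (d : nat) :
  (forall x y, G x y = false) ->
  #|stable_exponents G d| = 'C((d + #|V|).-1, d).
Proof.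
move=> G0; have [V0|] := posnP #|V|.
  have noV (x : V) : False by have /card0_eq/(_ x) := V0.
  rewrite V0 addn0; case: d => [|d]; first by rewrite card_stable_exponents0.
  rewrite bin_small ?ltnSn //; apply/eqP; rewrite cards_eq0; apply/eqP/setP => f.
  by rewrite !inE big1 // => x; case: (noV x).
case EV : #|V| => [//|n] _; rewrite addnS /= addnC -bin_sub ?leq_addl // addnK.
rewrite -card_ord_partitions -EV.
have inj_fgraph : injective (@fgraph V 'I_d.+1) by exact: can_inj fgraphK.
have sum_fgraph (f : {ffun V -> 'I_d.+1}) :
    (\sum_(i <- fgraph f) i = \sum_x f x)%N by rewrite big_map enumT.
rewrite -(card_imset _ inj_fgraph); apply: eq_card => t.
apply/imsetP/idP => [[f + ->]|]; first by rewrite !inE sum_fgraph => /andP[].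
rewrite inE => sum_t; exists (Finfun t); last by rewrite FinfunK.
rewrite inE -sum_fgraph FinfunK sum_t /=.
by apply/forallP => x; apply/forallP => y; rewrite G0.
Qed.

Lemma coefs_one_subX_mul (f : fps int) d :
  coefs ((1 - fpsX) * f) d = coefs f d - (if d is k.+1 then coefs f k else 0).
Proof.
rewrite mulrBl mul1r; congr (_ - _).
case: d => [|d]; rewrite /= big_ord_recl /= mul0r ?big_ord0 // add0r.
by rewrite big_ord_recl /= mul1r subSS subn0 big1 ?addr0 // => i _; rewrite mul0r.
Qed.

(** Multiplication by 1 - t takes first differences of coefficients, and by
    Pascal's rule this turns the binomial series for n + 1 into that for n. *)
Lemma inv_one_subX_exp n :
  1 / (1 - fpsX) ^+ n = Fps (fun d => 'C((d + n).-1, d)%:Z).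
Proof.
rewrite mul1r; apply: mulr1_eq; elim: n => [|n IHn].
  rewrite mul1r; apply: fpsP => -[|d] //=.
  by rewrite addn0 bin_small.
rewrite exprSr -mulrA -[RHS]IHn; congr (_ * _).
apply: fpsP => d; rewrite coefs_one_subX_mul /=.
case: d => [|d]; first by rewrite !bin0 subr0.
by rewrite !addnS !addSn /= binS PoszD addrK.
Qed.

Lemma hilbert_series_edgeless (K : fieldType) (V : finType) (G : sgraph V) :
  (forall x y, G x y = false) ->
  hilbert_series K G = 1 / (1 - fpsX) ^+ #|V|.
Proof.
move=> G0; rewrite inv_one_subX_exp; apply: fpsP => d.
by rewrite coefs_hilbert_series card_stable_exponents_edgeless.
Qed.

(** Graphs with the same adjacency may still differ in the proofs they carry;
    the count of stable monomials sees only the adjacency. *)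
Lemma eq_hilbert_series (K : fieldType) (V : finType) (G H : sgraph V) :
  G =2 H -> hilbert_series K G = hilbert_series K H.
Proof.
move=> GH; apply: fpsP => d; rewrite !coefs_hilbert_series; congr Posz.
apply: eq_card => f; rewrite !inE; congr (_ && _).
by apply: eq_forallb => x; apply: eq_forallb => y; rewrite GH.
Qed.

Lemma complement_complete (V : finType) x y :
  complement (complete V) x y = false.
Proof. exact: andbN. Qed.

Theorem corollary4p16 (K : fieldType) :
  (forall (V : finType) (G : sgraph V) (m : nat),
     hilbert_series K (join G (complement (complete 'I_m))) =
       hilbert_series K G + 1 / (1 - fpsX) ^+ m - 1)
  /\ (forall m n : nat,
     hilbert_series K (complete_bipartite m n) =
       1 / (1 - fpsX) ^+ n + 1 / (1 - fpsX) ^+ m - 1).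
Proof.
have edgeless m : hilbert_series K (complement (complete 'I_m)) =
    1 / (1 - fpsX) ^+ m.
  rewrite hilbert_series_edgeless ?card_ord //; exact: complement_complete.
split=> [V G m|m n]; first by rewrite hilbert_series_join edgeless.
have -> : hilbert_series K (complete_bipartite m n) =
    hilbert_series K (join (complement (complete 'I_m))
                           (complement (complete 'I_n))).
  by apply: eq_hilbert_series => -[x|x] [y|y] //=; rewrite andbN.
by rewrite hilbert_series_join !edgeless [X in X - 1]addrC.
Qed.
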